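(* Let the state of the Track-MDP at time $k$ be $s_k=(x_{l(k)},n(k),h_k)$, with $n(k)\le T_{\max}$. For the process Markov chain $(X_k)_{k\ge 0}$ with state transition probability matrix $P$, all grid positions $b^j\in\mathcal X$ such that $$\mathrm{Pr}(X_{k+1}=b^j\mid s_k)>\frac{c}{r}$$ will have their sensors turned on by the optimal policy $\pi^*_{\mathrm{TMDP}}$ of the Track-MDP (i.e. $b^j\in\pi^*_{\mathrm{TMDP}}(s_k)$).
   Context: Target. An $N\times N$ sensing grid has cells $\bar{\mathcal X}=\{b^1,\dots,b^{N^2}\}$ (the grid positions), each containing a sensor, and $\mathcal X=\bar{\mathcal X}\cup\{b^T\}$. The target position $(X_k)_{k\ge 0}$ (values $x_k$) is a time-homogeneous Markov chain on $\mathcal X$ with transition matrix $P$; the terminal state $b^T$ (target has left the grid) is absorbing, and exit from the grid is detected unambiguously. Actions and observations. The action space is $\mathcal A=2^{\bar{\mathcal X}}$; an action $a_k$ is the set of sensors turned on at time $k$. The observation is $y_k=x_k$ if $x_k\in a_k$, and $y_k=\mathcal E$ (uninformative) if $x_k\notin a_k$. Safe sensing constraint: an integer $T_{\max}>0$ is fixed, and if the target has been unobserved for $T_{\max}+1$ time steps the action is constrained to be a designated safe sensing action $\hat a_s$, which observes the target with certainty (for example, activating a high-power sensor or all the sensors in the grid). Track-MDP. The state space is $\mathcal S=\{(x,n,h): x\in\mathcal X,\ 0\le n\le T_{\max}+1,\ h\in\mathcal A^n\}$, together with a terminal state $s_T$. The state at time $k$ is $s_k=(x_{l(k)},n(k),h_k)$,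 where $l(k)$ is the last time $\le k$ at which the target was observed ($y\neq\mathcal E$), $n(k)=k-l(k)$, and $h_k=(a_{l(k)+1},\dots,a_k)$ is the history of actions since then. After action $a_{k+1}$ in state $s_k$, the next state is $(x_{k+1},0,\emptyset)$ if $y_{k+1}=x_{k+1}$ or $n(k)=T_{\max}+1$; it is $(x_{l(k)},n(k)+1,(h_k,a_{k+1}))$ if $y_{k+1}=\mathcal E$ and $n(k)\le T_{\max}$; and it is $s_T$ if $x_{k+1}=b^T$. Reward. With positive constants $r,c,D$ ($-D$ is described as a large negative reward for using $\hat a_s$), the reward at time $k$ is $\big(r\,\mathbf 1_{\{n(k)=0\}}-c|a_k|\mathbf 1_{\{a_k\ne\hat a_s\}}-D\,\mathbf 1_{\{a_k=\hat a_s\}}\big)\mathbf 1_{\{x_k\neq b^T\}}$. Policies. A policy $\pi$ assigns to each state an action, $a_{k+1}=\pi(s_k)$, subject to the safe sensing constraint. $V^\pi(s_0)$ is the expected infinite-horizon sum of rewards (no discount factor) from initial state $s_0$. The optimal policy $\pi^*_{\mathrm{TMDP}}$ maximizes $V^\pi(s_0)$ for all possible initial states $s_0$. Conditional law. $\mathrm{Pr}(X_{k+1}=\bar b\mid s_k)$ is the conditional probability that the target is at $\bar b$ at time $k+1$ given the Track-MDP state $s_k$. It equals $P(\bar b,s_k)/\sum_{b}P(b,s_k)$, where $P(b,s_k)$ is the probability of the set of paths $(g_0,\dots,g_{n(k)+1})$ of the chain with $g_0=x_{l(k)}$, with $g_i$ not in the $i$-th action of $h_k$ for $1\le i\le n(k)$,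 and with $g_{n(k)+1}=b$, and the sum is over the $b\in\mathcal X$ for which this set of paths is non-empty (only positive-probability paths are considered).
   Formalization: Assumes that the target leaves the grid almost surely (b^T reachable from every state) and that D ≥ cN², making ''large negative reward'' precise; the safe sensing action is distinct from every subset of sensors and used only at n = T_max+1. The claim fails otherwise. *)

(* Defs.v *)
(* MathComp + MathComp-Analysis. *)
From HB Require Import structures.
From mathcomp Require Import all_boot all_order all_algebra.
From mathcomp Require Import all_classical all_reals all_analysis.
Import Order.TTheory GRing.Theory Num.Theory.
Import numFieldNormedType.Exports.

Set Implicit Arguments.
Unset Strict Implicit.
Unset Printing Implicit Defensive.

Local Open Scope ring_scope.

Definition cell (N : nat) : finType := ('I_N * 'I_N)%type.

(* [Some b] is the grid position b, [None] is the terminal state b^T. *)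
Definition pos (N : nat) : finType := option (cell N).

(* [Sense a] turns on exactly the sensors in a; [Safe] is the designated safe
   sensing action.  [Safe] is a label of its own, distinct from
   [Sense [set: cell N]]: both locate the target with certainty, but the former
   costs D and the latter c * N^2. *)
Inductive action (N : nat) : Type :=
  | Sense of {set cell N}
  | Safe.
Arguments Safe {N}.

(* A non-terminal state (x, n, h), h in A^n, 0 <= n <= Tmax + 1.  The length n
   is not stored: it is [age s], the size of the bounded sequence [hist s].
   Only subsets of the grid occur in h, since [Safe] always observes. *)
Record live (N Tmax : nat) : Type := Live {
  last_seen : pos N;
  hist : (Tmax.+1).-bseq {set cell N}
}.

Definition age (N Tmax : nat) (s : live N Tmax) : nat := size (hist s).

Section Chain.
Variables (R : realType) (N : nat) (P : pos N -> pos N -> R).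

Definition transition_matrix : Prop :=
  [/\ forall x y, 0 <= P x y, forall x, \sum_y P x y = 1 & P None None = 1].

Fixpoint path_prob (x : pos N) (g : seq (pos N)) : R :=
  if g is y :: g' then P x y * path_prob y g' else 1.

(* Absorbing chain: b^T can be reached from every state, i.e. the target leaves
   the grid almost surely. *)
Definition absorbing_chain : Prop :=
  forall x : pos N, exists g : seq (pos N), last x g = None /\ 0 < path_prob x g.

End Chain.

(* The observation is y itself when [seen u y] and the uninformative symbol
   otherwise, for a target on the grid. *)
Definition seen (N : nat) (u : action N) (b : cell N) : bool :=
  if u is Sense a then b \in a else true.

(* The outcome (E, no exit): as an exit is detected, an uninformative
   observation also tells that the target is still on the grid. *)
Definition unseen (N : nat) (y : pos N) (a : {set cell N}) : bool :=
  if y is Some b then ~~ seen (Sense a) b else false.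

Section TrackMDP.
Variables (R : realType) (N Tmax : nat) (P : pos N -> pos N -> R).
Variables (r c D : R).

Local Notation state := (live N Tmax).

(* [None] is the terminal state s_T. *)
Definition next (s : state) (u : action N) (y : pos N) : option state :=
  match y, u with
  | None, _ => None
  | Some b, Sense a =>
      if (b \in a) || (age s == Tmax.+1) then Some (Live y [bseq])
      else Some (Live (last_seen s) (insub_bseq Tmax.+1 (rcons (hist s) a)))
  | Some _, Safe => Some (Live y [bseq])
  end.

(* Probability that the chain started at x_{l(k)} avoids the sensors recorded
   in h during the steps l(k)+1, ..., k, stays on the grid until time k, and
   then runs through f.  In particular [joint s [:: b]] is P(b, s). *)
Definition joint (s : state) (f : seq (pos N)) : R :=
  \sum_(g : (age s).-tuple (pos N) | all2 (@unseen N) g (hist s))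
     path_prob P (last_seen s) (g ++ f).

(* Conditional probability of (X_{k+1}, ..., X_{k + size f}) = f given s_k = s;
   Pr(X_{k+1} = b | s) is the case f = [:: b]. *)
Definition cond_prob (s : state) (f : seq (pos N)) : R :=
  joint s f / \sum_(b : pos N) joint s [:: b].

(* The states that have a positive-probability path; on the others the
   conditional law is 0 / 0. *)
Definition possible (s : state) : Prop := 0 < \sum_(b : pos N) joint s [:: b].

Definition policy := state -> action N.

Definition admissible (pi : policy) : Prop :=
  forall s : state, pi s = Safe <-> age s = Tmax.+1.

Definition cost (u : action N) : R :=
  if u is Sense a then c * #|a|%:R else D.

(* Reward collected at a time k+1 when s_k = s, a_{k+1} = u and x_{k+1} = y. *)
Definition reward (s : state) (u : action N) (y : pos N) : R :=
  if next s u y is Some s' then r * (age s' == 0%N)%:R - cost u else 0.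

(* The state reached from s under pi when the target then moves along f. *)
Definition track (pi : policy) (s : state) (f : seq (pos N)) : option state :=
  foldl (fun os y => obind (fun s' => next s' (pi s') y) os) (Some s) f.

(* Expectation of the reward at time k+1 given s_0 = s: f = (x_1, ..., x_k) and
   y = x_{k+1}. *)
Definition expected_reward (pi : policy) (s : state) (k : nat) : R :=
  \sum_(f : k.-tuple (pos N)) \sum_(y : pos N)
    cond_prob s (rcons f y) *
    (if track pi s f is Some s' then reward s' (pi s') y else 0).

(* Rewards are summed from time 1 on: the reward at time 0 depends on s_0 and
   on the action taken before it, not on pi.  The series converges when P is an
   absorbing chain. *)
Definition value (pi : policy) (s : state) : R :=
  limn (series (expected_reward pi s)).

Definition optimal (pi : policy) : Prop :=
  admissible pi /\
  forall pi' : policy, admissible pi' ->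
    forall s : state, possible s -> value pi' s <= value pi s.

End TrackMDP.

(* Main.v *)
(* All values are multiplied by the probability [mass] of the observations made
   so far; the weighted value of a state is driven by an unnormalised belief
   on the target position that evolves linearly.  Absorption makes the expected
   time on the grid bounded, so reward series converge and policy improvement
   gives the Bellman inequality for every admissible action.  By backward
   induction on the age, the optimal value is subadditive under splitting the
   belief (more information cannot hurt).  If the optimal action a at s missed a
   cell b with probability p > c / r, then playing a + b instead would gain
   r p - c at once, or more, and lose nothing later, since it only splits the
   belief of the unobserved outcome into the target at b and the rest. *)
Require Import Defs.
From mathcomp Require Import all_boot all_order all_algebra.
From mathcomp Require Import all_classical all_reals all_analysis.
From mathcomp Require Import ring lra.
Import Order.TTheory GRing.Theory Num.Theory.
Import numFieldNormedType.Exports.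
Set Implicit Arguments.
Unset Strict Implicit.
Unset Printing Implicit Defensive.

Local Open Scope ring_scope.

(** * Sums over paths and over target positions *)

Lemma big_tuple_cons (R : nmodType) (T : finType) n (Q : pred (seq T))
    (F : seq T -> R) :
  \sum_(g : n.+1.-tuple T | Q g) F g =
  \sum_(y : T) \sum_(g : n.-tuple T | Q (y :: g)) F (y :: g).
Proof.
rewrite pair_big_dep /=.
rewrite (reindex (fun p : T * n.-tuple T => [tuple of p.1 :: p.2])) //=.
exists (fun g => (thead g, [tuple of behead g])) => [[y g] _|g _] /=.
  by rewrite theadE; congr pair; apply: val_inj.
by rewrite [in RHS](tuple_eta g).
Qed.

Lemma big_pos (R : nmodType) N (Q : pred (pos N)) (F : pos N -> R) :
  ~~ Q None -> \sum_(y | Q y) F y = \sum_(b : cell N | Q (Some b)) F (Some b).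
Proof.
move=> nQ; rewrite (bigID (fun y : pos N => y == None)) /=.
rewrite big1 ?add0r => [|y /andP[Qy /eqP y0]].
  2: by rewrite y0 (negbTE nQ) in Qy.
rewrite (reindex_omap Some id) => [|[]//]; last by move=> /andP[].
by apply: eq_bigl => b /=; rewrite eqxx !andbT.
Qed.

(** * The unnormalised belief and its one-step evolution *)

Section Belief.
Context {R : realType} {N Tmax : nat}.
Variable P : pos N -> pos N -> R.

Definition trans (phi : pos N -> R) (x : pos N) : R := \sum_y P x y * phi y.

(* Expectation of phi(X_k) over the paths from x that escape the sensors in h
   during the k = size h steps, not divided by the probability of escaping. *)
Fixpoint escape (x : pos N) (h : seq {set cell N}) (phi : pos N -> R) : R :=
  if h is a :: h' then \sum_(y | unseen y a) P x y * escape y h' phi else phi x.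

(** The unnormalised belief at [s], encoded as a linear functional on test functions; at [P^~ y] it
    weighs the event that the target moves next to [y]. *)
Definition mass (s : live N Tmax) := escape (last_seen s) (hist s).

(** [escape] recurses on the earliest action, whereas a new miss is appended at the end of the
    history. *)
Lemma escape_rcons x h a phi : escape x (rcons h a) phi =
  escape x h (fun z => \sum_(y | unseen y a) P z y * phi y).
Proof.
by elim: h x => [//|a' h IH] x /=; apply: eq_bigr => y _; rewrite IH.
Qed.

Lemma escape_sum (I : finType) (Q : pred I) (k : I -> R)
    (phi : I -> pos N -> R) x h :
  escape x h (fun z => \sum_(i | Q i) k i * phi i z) =
  \sum_(i | Q i) k i * escape x h (phi i).
Proof.
elim: h x => [//|a h IH] x /=.
under eq_bigr do rewrite IH mulr_sumr.
rewrite exchange_big /=; apply: eq_bigr => i _; rewrite mulr_sumr.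
by apply: eq_bigr => y _; ring.
Qed.

Lemma massZ s k phi : mass s (fun z => k * phi z) = k * mass s phi.
Proof.
case: s => [x0 [h0 sz]]; rewrite /mass /= {sz}; elim: h0 x0 => //= a h IH x.
by rewrite mulr_sumr; apply: eq_bigr => y _; rewrite IH; ring.
Qed.

Lemma mass_step (s : live N Tmax) (Q : pred (pos N)) phi :
  mass s (fun z => \sum_(y | Q y) P z y * phi y) =
  \sum_(y | Q y) mass s (P^~ y) * phi y.
Proof.
under [RHS]eq_bigr do rewrite mulrC.
rewrite -escape_sum; congr escape; apply/funext => z.
by apply: eq_bigr => y _; ring.
Qed.

Lemma joint_mass s f : joint P s f = mass s (path_prob P ^~ f).
Proof.
rewrite /joint /mass /age; case: s => x [h _] /=.
elim: h x => [|a h IH] x /=.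
  rewrite (big_pred1 [tuple]) => [|g]; first by [].
  by rewrite !tuple0.
rewrite (@big_tuple_cons _ _ _ (fun g => all2 (@unseen N) g (a :: h))
  (fun g => path_prob P x (g ++ f))) [RHS]big_mkcond /=.
apply: eq_bigr => y _; case: ifP => uy; last by rewrite big_pred0.
by rewrite -IH mulr_sumr.
Qed.

Lemma joint1_mass s y : joint P s [:: y] = mass s (P^~ y).
Proof.
by rewrite joint_mass; congr escape; apply/funext => x /=; rewrite mulr1.
Qed.

(** The Markov property: once the target is at [y], the rest of the path no longer depends on
    [s]. *)
Lemma joint_cons s y f :
  joint P s (y :: f) = mass s (P^~ y) * path_prob P y f.
Proof.
rewrite joint_mass /= mulrC -massZ.
by congr escape; apply/funext => x; rewrite mulrC.
Qed.

(** Meaningful only for [age s <= Tmax]: on a longer history [insub_bseq] returns its default, the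
    empty sequence. *)
Definition miss (s : live N Tmax) (a : {set cell N}) : live N Tmax :=
  Live (last_seen s) (insub_bseq Tmax.+1 (rcons (hist s) a)).

Lemma age_le (s : live N Tmax) : (age s <= Tmax.+1)%N.
Proof. exact: size_bseq. Qed.

Lemma hist_miss s a : (age s <= Tmax)%N ->
  hist (miss s a) = rcons (hist s) a :> seq {set cell N}.
Proof.
by move=> le_s; rewrite /= /insub_bseq insubdK // -topredE /= size_rcons.
Qed.

Lemma age_miss s a : (age s <= Tmax)%N -> age (miss s a) = (age s).+1.
Proof. by move=> le_s; rewrite /age hist_miss // size_rcons. Qed.

Lemma mass_miss s a phi : (age s <= Tmax)%N ->
  mass (miss s a) phi = \sum_(y | unseen y a) mass s (P^~ y) * phi y.
Proof.
by move=> le_s; rewrite {1}/mass hist_miss // escape_rcons -mass_step.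
Qed.

(** The history is empty, so [mass] is evaluation at [Some b], and raw values at this state are true
    conditional values. *)
Definition located (b : cell N) : live N Tmax := Live (Some b) [bseq].

Definition resets (s : live N Tmax) (u : action N) (b : cell N) : bool :=
  if u is Sense a then (b \in a) || (age s == Tmax.+1) else true.

(* phi (miss s a) carries no weight because functions of a state are meant to be
   already multiplied by the mass of that state (which is 1 for located b). *)
Definition backup (s : live N Tmax) (u : action N)
    (phi : live N Tmax -> R) : R :=
  \sum_(b | resets s u b) mass s (P^~ (Some b)) * phi (located b) +
  (if u is Sense a then if age s == Tmax.+1 then 0 else phi (miss s a) else 0).

Lemma backupB s u phi psi :
  backup s u (fun t => phi t - psi t) = backup s u phi - backup s u psi.
Proof.
rewrite /backup; under eq_bigr do rewrite mulrBr.
rewrite sumrB; case: u => [a|]; last ring.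
by case: ifP => _; ring.
Qed.

Lemma backupZ s u k phi : backup s u (fun t => k * phi t) = k * backup s u phi.
Proof.
rewrite /backup mulrDr mulr_sumr; congr (_ + _).
  by apply: eq_bigr => b _; ring.
by case: u => [a|]; rewrite ?mulr0 //; case: ifP; rewrite ?mulr0.
Qed.

Lemma backup_sum s u (phi : nat -> live N Tmax -> R) n :
  backup s u (fun t => \sum_(0 <= i < n) phi i t) =
  \sum_(0 <= i < n) backup s u (phi i).
Proof.
rewrite /backup big_split /=; congr (_ + _).
  by rewrite exchange_big; apply: eq_bigr => b _; rewrite mulr_sumr.
by case: u => [a|]; [case: ifP => // _|]; rewrite big1.
Qed.

Hypothesis P_ge0 : forall x y, 0 <= P x y.

Lemma mass_ge0 s (phi : pos N -> R) : (forall x, 0 <= phi x) -> 0 <= mass s phi.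
Proof.
case: s => [x0 [h0 sz]] phi0; rewrite /mass /= {sz}.
elim: h0 x0 => //= a h IH x.
by apply: sumr_ge0 => y _; rewrite mulr_ge0.
Qed.

Lemma mass_le s (phi psi : pos N -> R) :
  (forall x, phi x <= psi x) -> mass s phi <= mass s psi.
Proof.
case: s => [x0 [h0 sz]] le_phi; rewrite /mass /= {sz}.
elim: h0 x0 => //= a h IH x.
by apply: ler_sum => y _; rewrite ler_wpM2l.
Qed.

Lemma mass_sum s n (phi : nat -> pos N -> R) :
  mass s (fun x => \sum_(0 <= k < n) phi k x) =
  \sum_(0 <= k < n) mass s (phi k).
Proof.
case: s => [x0 [h0 sz]]; rewrite /mass /= {sz}.
elim: h0 x0 => //= a h IH x; rewrite exchange_big /=.
by apply: eq_bigr => y _; rewrite IH mulr_sumr.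
Qed.

Lemma backup_le s u (phi psi : live N Tmax -> R) :
  (forall t, phi t <= psi t) -> backup s u phi <= backup s u psi.
Proof.
move=> le_t; rewrite /backup lerD //; last by case: u => // a; case: ifP.
by apply: ler_sum => b _; rewrite ler_wpM2l // mass_ge0.
Qed.

Lemma backup_norm s u (phi : live N Tmax -> R) :
  `|backup s u phi| <= backup s u (fun t => `|phi t|).
Proof.
rewrite ler_norml -mulN1r -backupZ; apply/andP; split; apply: backup_le => t.
  by rewrite mulN1r lerNl -normrN ler_norm.
exact: ler_norm.
Qed.

End Belief.

(** * Geometric decay of the probability of staying on the grid *)

Section Absorption.
Context {R : realType} {N : nat}.
Variable P : pos N -> pos N -> R.
Hypothesis P_tm : transition_matrix P.

Let P_ge0 x y : 0 <= P x y. Proof. by case: P_tm. Qed.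
Let P_sum1 x : \sum_y P x y = 1. Proof. by case: P_tm. Qed.

(** The probability that a target starting at [x] is still on the grid after [k] steps. *)
Definition alive (k : nat) : pos N -> R :=
  iter k (trans P) (fun x => (x != None)%:R).
#[global] Arguments alive : simpl never.

Lemma aliveS k x : alive k.+1 x = \sum_y P x y * alive k y.
Proof. by []. Qed.

Lemma trans_le (phi psi : pos N -> R) :
  (forall x, phi x <= psi x) -> forall x, trans P phi x <= trans P psi x.
Proof. by move=> le_phi x; apply: ler_sum => y _; rewrite ler_wpM2l. Qed.

Lemma alive_ge0 k x : 0 <= alive k x.
Proof.
elim: k x => [|k IH] x; first exact: ler0n.
by rewrite aliveS; apply: sumr_ge0 => y _; rewrite mulr_ge0.
Qed.

(** The diagonal entry already exhausts the row sum, so the other nonnegative entries vanish. *)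
Lemma P_None y : P None y = (y == None)%:R.
Proof.
have PNN : P None None = 1 by case: P_tm.
have := P_sum1 None; rewrite (bigD1 None) //= PNN => /(canRL (addKr _)).
rewrite addNr => /eqP; rewrite psumr_eq0 // => /allP P0.
case: y => [b|]; last by rewrite PNN.
by have /eqP := P0 (Some b) (mem_index_enum _).
Qed.

Lemma alive_None k : alive k None = 0.
Proof.
elim: k => [|k IH]; first by [].
rewrite aliveS big1 // => y _; rewrite P_None.
by case: y => [b|]; rewrite ?mul0r // IH mulr0.
Qed.

Lemma alive_noninc m n x : (m <= n)%N -> alive n x <= alive m x.
Proof.
move=> /subnK <-; elim: (n - m)%N => [//|k IH]; apply: le_trans IH.
rewrite addSn; elim: (k + m)%N x => [|{}k IH] x; last exact: trans_le.
case: x => [b|]; last by rewrite !alive_None.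
rewrite aliveS [leRHS](_ : _ = \sum_y P (Some b) y); last by rewrite P_sum1.
by apply: ler_sum => y _; rewrite ler_piMr // lern1 leq_b1.
Qed.

Lemma alive_le1 k x : alive k x <= 1.
Proof.
by apply: (le_trans (alive_noninc x (leq0n k))); rewrite lern1 leq_b1.
Qed.

(** A target that follows [g] has left the grid, so the probability of [g] is lost to survival. *)
Lemma alive_path x g :
  last x g = None -> alive (size g) x <= 1 - path_prob P x g.
Proof.
elim: g x => [|y g IH] x /=; first by move=> ->; rewrite alive_None subrr.
move=> /IH le_y; rewrite aliveS.
rewrite -[in leRHS](P_sum1 x) (bigD1 y) //= [in leRHS](bigD1 y) //=.
rewrite addrAC lerD //.
  by rewrite -{2}[P x y]mulr1 -mulrBr ler_wpM2l.
by apply: ler_sum => z _; rewrite ler_piMr // alive_le1.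
Qed.

(** There are finitely many positions, each with an exit path: [K] is the greatest length of these
    paths and [theta] the largest survival probability over [K] steps. *)
Lemma alive_contracts : absorbing_chain P ->
  exists K theta, [/\ 0 <= theta, theta < 1 &
    forall j x, alive (j + K) x <= theta * alive j x].
Proof.
move=> /choice[g gP].
pose K := (\max_(x : pos N) size (g x))%N.
pose theta : R := \big[Num.max/0]_(x : pos N) alive K x.
have theta0 : 0 <= theta by apply: bigmax_ge_id.
have theta1 : theta < 1.
  apply: bigmax_lt => [|x _]; first exact: ltr01.
  have [lx px] := gP x.
  have le_K := leq_bigmax (F := fun x => size (g x)) x.
  apply: (le_lt_trans (alive_noninc x le_K)).
  by apply: (le_lt_trans (alive_path lx)); rewrite ltrBlDr ltrDl.
exists K, theta; split=> //; elim=> [|j IH] x.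
  case: x => [b|]; last by rewrite !alive_None mulr0.
  by rewrite {2}/alive /= mulr1; apply: le_bigmax.
rewrite addSn aliveS mulr_sumr.
by apply: (le_trans (trans_le IH x)); apply: ler_sum => y _; rewrite mulrCA.
Qed.

Lemma sum_alive_bounded : absorbing_chain P ->
  exists2 B : R, 0 <= B &
    forall n x, \sum_(0 <= k < n) alive k x <= B * alive 0 x.
Proof.
move=> /alive_contracts[K [theta [theta0 theta1 contr]]].
have d0 : 0 < 1 - theta by rewrite subr_gt0.
exists (K%:R / (1 - theta)) => [|n x]; first by rewrite divr_ge0 // ltW.
case: x => [b|]; last first.
  by rewrite big1 ?alive_None ?mulr0 // => k _; rewrite alive_None.
(* With S the partial sum, this reduces to S <= K + theta S: the first [K] terms are at most 1, and
   each later term is at most [theta] times the term [K] places earlier. *)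
rewrite {2}/alive /= mulr1 ler_pdivlMr // mulrBr mulr1 lerBlDr.
apply: (@le_trans _ _ (\sum_(0 <= k < K + n) alive k (Some b))).
  rewrite [leRHS](@big_cat_nat _ _ _ n) ?leq_addl //= lerDl.
  by apply: sumr_ge0 => k _; apply: alive_ge0.
rewrite (@big_cat_nat _ _ _ K) ?leq_addr //= lerD //.
  rewrite -[K in K%:R]subn0 -sumr_const_nat.
  by apply: ler_sum => k _; apply: alive_le1.
rewrite -{1}[K]add0n big_addn addKn mulr_suml.
by apply: ler_sum => k _; rewrite mulrC contr.
Qed.

End Absorption.

(** * Convergence of the reward series and the evaluation equation of a policy *)

Section PolicyEvaluation.
Context {R : realType} {N Tmax : nat}.
Variable P : pos N -> pos N -> R.
Variables r c D : R.
Hypotheses (r_gt0 : 0 < r) (c_gt0 : 0 < c) (D_gt0 : 0 < D).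
Hypotheses (P_tm : transition_matrix P) (P_abs : absorbing_chain P).

Let P_ge0 x y : 0 <= P x y. Proof. by case: P_tm. Qed.
Local Notation state := (live N Tmax).

Lemma next_resets (s : state) u b :
  resets s u b -> Defs.next s u (Some b) = Some (located b).
Proof. by case: u => [a|] //= ->. Qed.

Lemma next_misses (s : state) a b : ~~ resets s (Sense a) b ->
  Defs.next s (Sense a) (Some b) = Some (miss s a).
Proof. by move=> /= /negbTE ->. Qed.

Lemma not_resetsE (s : state) a b : age s != Tmax.+1 ->
  ~~ resets s (Sense a) b = (b \notin a).
Proof. by move=> /= /negbTE ->; rewrite orbF. Qed.

Lemma reward_None (s : state) u : reward r c D s u None = 0.
Proof. by []. Qed.

Lemma reward_Some (s : state) u b :
  reward r c D s u (Some b) = r * (resets s u b)%:R - cost c D u.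
Proof.
have [rs|rs] := boolP (resets s u b); first by rewrite /reward next_resets.
(* A missed target forces [age s <= Tmax], so the new age is a successor and [r] is not earned. *)
case: u rs => // a rs; rewrite /reward next_misses // age_miss //.
by move: rs; rewrite negb_or -ltnS => /andP[_]; rewrite ltn_neqAle age_le andbT.
Qed.

Definition gain (s : state) (u : action N) : R :=
  \sum_y mass P s (P^~ y) * reward r c D s u y.

Lemma gainE s u : gain s u =
  \sum_(b : cell N)
     mass P s (P^~ (Some b)) * (r * (resets s u b)%:R - cost c D u).
Proof.
rewrite /gain (bigD1 None) //= reward_None mulr0 add0r big_pos //=.
by apply: eq_big => // b _; rewrite reward_Some.
Qed.

(** The outcomes of any action partition the target's next positions on the grid, so survival does
    not depend on the action. *)
Lemma backup_alive s u k :
  backup P s u (fun t : state => mass P t (alive P k)) =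
  mass P s (alive P k.+1).
Proof.
have -> : mass P s (alive P k.+1) =
    \sum_(b : cell N) mass P s (P^~ (Some b)) * alive P k (Some b).
  rewrite [LHS](mass_step P s xpredT (alive P k)) (bigD1 None) //=.
  by rewrite alive_None // mulr0 add0r big_pos.
rewrite (bigID (resets s u)) /=; congr (_ + _).
case: u => [a|]; last by rewrite big_pred0.
case: ifPn => [/eqP s_max|s_max].
  by rewrite big_pred0 // => b; rewrite /= s_max eqxx orbT.
rewrite mass_miss; last by rewrite -ltnS ltn_neqAle s_max age_le.
by rewrite big_pos //; apply: eq_bigl => b; rewrite not_resetsE.
Qed.

Let C : R := r + c * #|cell N|%:R + D.

Lemma gain_bound s u : `|gain s u| <= C * mass P s (alive P 1).
Proof.
have -> : mass P s (alive P 1) = \sum_(b : cell N) mass P s (P^~ (Some b)).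
  rewrite [LHS](mass_step P s xpredT (alive P 0)) (bigD1 None) //=.
  rewrite alive_None // mulr0 add0r big_pos //.
  by apply: eq_bigr => b _; exact: mulr1.
rewrite gainE mulr_sumr; apply: (le_trans (ler_norm_sum _ _ _)).
apply: ler_sum => b _; rewrite normrM ger0_norm ?mass_ge0 // mulrC.
rewrite ler_wpM2r ?mass_ge0 //.
have cost_ge0 : 0 <= cost c D u.
  by case: u => [a|] /=; rewrite ?(ltW D_gt0) ?mulr_ge0 ?(ltW c_gt0).
have cost_le : cost c D u <= c * #|cell N|%:R + D.
  case: u {cost_ge0} => [a|] /=; last by rewrite lerDr mulr_ge0 ?(ltW c_gt0).
  by apply: ler_wpDr; [exact: ltW | rewrite ler_pM2l // ler_nat max_card].
have rr : 0 <= r * (resets s u b)%:R <= r.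
  by case: (resets _ _ _); rewrite ?mulr1 ?mulr0 lexx (ltW r_gt0).
by rewrite /C ler_norml; move: rr cost_ge0 cost_le => /andP[]; lra.
Qed.

(** The numerator of [expected_reward]. The denominator depends on [s] only, and dropping it makes
    the first-step recursion linear. *)
Definition raw_reward (pi : policy N Tmax) (s : state) (k : nat) : R :=
  \sum_(f : k.-tuple (pos N)) \sum_(y : pos N)
    joint P s (rcons f y) *
    (if track pi s f is Some s' then reward r c D s' (pi s') y else 0).

Lemma expected_rewardE pi s k : expected_reward P r c D pi s k =
  raw_reward pi s k / \sum_(b : pos N) joint P s [:: b].
Proof.
rewrite /expected_reward mulr_suml; apply: eq_bigr => f _.
by rewrite mulr_suml; apply: eq_bigr => y _; rewrite mulrAC.
Qed.

Lemma raw_reward0 pi s : raw_reward pi s 0 = gain s (pi s).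
Proof.
rewrite /raw_reward (big_pred1 [tuple]) => [|f]; last first.
  by apply/esym/eqP; rewrite (tuple0 f).
by apply: eq_bigr => y _; rewrite joint1_mass.
Qed.

Lemma raw_rewardS pi s k :
  raw_reward pi s k.+1 = backup P s (pi s) (raw_reward pi ^~ k).
Proof.
pose step os y := obind (fun s' : state => Defs.next s' (pi s') y) os.
pose v os f y : R :=
  if foldl step os f is Some s' then reward r c D s' (pi s') y else 0.
(* [G y0 os] is the expected reward [k] steps later, once the target is at [y0] and the tracker in
   state [os]. *)
pose G y0 os := \sum_(f : k.-tuple (pos N)) \sum_y
  path_prob P y0 (rcons f y) * v os f y.
have vNone f y : v None f y = 0.
  by rewrite /v (_ : foldl step None f = None) //; elim: f.
have GNone y0 : G y0 None = 0.
  by apply: big1 => f _; apply: big1 => y _; rewrite vNone mulr0.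
have -> : raw_reward pi s k.+1 =
    \sum_y0 mass P s (P^~ y0) * G y0 (Defs.next s (pi s) y0).
  rewrite /raw_reward (@big_tuple_cons _ _ _ xpredT (fun f => \sum_y
    joint P s (rcons f y) *
    (if track pi s f is Some s' then reward r c D s' (pi s') y else 0))) /=.
  apply: eq_bigr => y0 _; rewrite mulr_sumr; apply: eq_bigr => f _.
  by rewrite mulr_sumr; apply: eq_bigr => y _; rewrite joint_cons -mulrA.
have locE b : raw_reward pi (located b) k = G (Some b) (Some (located b)).
  by apply: eq_bigr => f _; apply: eq_bigr => y _; rewrite joint_mass.
rewrite (bigD1 None) // -[RHS]add0r; congr (_ + _).
  by rewrite /= GNone mulr0.
rewrite /backup big_pos // (bigID (resets s (pi s))); congr (_ + _).
  by apply: eq_bigr => b rs; rewrite next_resets // locE.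
case: (pi s) => [a|]; last by rewrite big_pred0.
case: ifPn => [/eqP s_max|s_max].
  by rewrite big_pred0 // => b; rewrite /= s_max eqxx orbT.
have s_le : (age s <= Tmax)%N by rewrite -ltnS ltn_neqAle s_max age_le.
(* All missed positions lead to the same tracker state, so summing over them first rebuilds the
   belief of [miss s a]. *)
rewrite (eq_bigr (fun b =>
    mass P s (P^~ (Some b)) * G (Some b) (Some (miss s a)))).
  rewrite (eq_bigl (fun b => unseen (Some b) a)) => [|b].
    2: by rewrite not_resetsE.
  rewrite -(@big_pos _ _ (fun y => unseen y a)
    (fun y0 => mass P s (P^~ y0) * G y0 (Some (miss s a)))) //.
  under eq_bigr do rewrite mulr_sumr.
  rewrite exchange_big; apply: eq_bigr => f _ /=.
  under eq_bigr do rewrite mulr_sumr.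
  rewrite exchange_big; apply: eq_bigr => y _ /=.
  rewrite joint_mass mass_miss // mulr_suml; apply: eq_bigr => y0 _.
  by rewrite mulrA.
by move=> b rs; rewrite next_misses.
Qed.

Lemma raw_reward_bound pi s k :
  `|raw_reward pi s k| <= C * mass P s (alive P k.+1).
Proof.
elim: k s => [|k IH] s; first by rewrite raw_reward0 gain_bound.
rewrite raw_rewardS; apply: (le_trans (backup_norm P_ge0 _ _ _)).
by rewrite -(backup_alive s (pi s)) -backupZ; apply: backup_le.
Qed.

Lemma sum_mass_alive : exists2 B : R, 0 <= B &
  forall n (s : state),
    \sum_(0 <= k < n) mass P s (alive P k) <= B * mass P s (alive P 0).
Proof.
have [B B0 le_B] := sum_alive_bounded P_tm P_abs; exists B => // n s.
by rewrite -mass_sum -massZ; apply: (mass_le P_ge0) => x; apply: le_B.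
Qed.

Lemma mass_alive_cvg0 (s : state) :
  (mass P s (alive P n) @[n --> \oo] --> 0)%classic.
Proof.
have [B B0 le_B] := sum_mass_alive.
have ge0 k : 0 <= mass P s (alive P k).
  by apply: mass_ge0 => // x; exact: alive_ge0.
apply: cvg_series_cvg_0; apply: nondecreasing_is_cvgn.
  by apply/nondecreasing_seqP => n; rewrite seriesSr lerDl.
by exists (B * mass P s (alive P 0)) => _ [n _ <-]; apply: le_B.
Qed.

Lemma raw_reward_norm_sum : exists2 B : R, 0 <= B & forall pi s n,
  \sum_(0 <= k < n) `|raw_reward pi s k| <= B * mass P s (alive P 0).
Proof.
have [B B0 le_B] := sum_mass_alive.
have C0 : 0 <= C.
  by rewrite !addr_ge0 ?mulr_ge0 ?(ltW r_gt0) ?(ltW c_gt0) ?(ltW D_gt0).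
exists (C * B) => [|pi s n]; first exact: mulr_ge0.
(* The reward of index [k] is controlled by [alive] at [k.+1]; the extra nonnegative term of index 0
   absorbs this shift. *)
apply: (@le_trans _ _ (C * \sum_(0 <= k < n.+1) mass P s (alive P k))).
  rewrite mulr_sumr big_nat_recl // ler_wpDl //.
    by rewrite mulr_ge0 // mass_ge0 // => x; exact: alive_ge0.
  by apply: ler_sum => k _; apply: raw_reward_bound.
by rewrite -mulrA ler_wpM2l.
Qed.

Lemma raw_reward_cvg pi s : cvgn (series (raw_reward pi s)).
Proof.
have [B B0 le_B] := raw_reward_norm_sum.
apply: normed_cvg; apply: nondecreasing_is_cvgn.
  apply/nondecreasing_seqP => n.
  rewrite -[leRHS]/(\sum_(0 <= k < n.+1) `|raw_reward pi s k|).
  by rewrite big_nat_recr //= lerDl.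
by exists (B * mass P s (alive P 0)) => _ [n _ <-]; apply: le_B.
Qed.

(* The value of pi times the probability of the observations leading to s. *)
Definition raw_value pi s : R := limn (series (raw_reward pi s)).

Lemma valueE pi s :
  value P r c D pi s = raw_value pi s / \sum_(b : pos N) joint P s [:: b].
Proof.
apply/cvg_lim => //; rewrite (_ : series _ = fun n =>
    series (raw_reward pi s) n / \sum_(b : pos N) joint P s [:: b]).
  by apply: cvgMr_tmp; apply: raw_reward_cvg.
apply/funext => n; rewrite /series /= mulr_suml.
by apply: eq_bigr => k _; rewrite expected_rewardE.
Qed.

Lemma raw_value_bound : exists2 B : R, 0 <= B &
  forall pi s, `|raw_value pi s| <= B * mass P s (alive P 0).
Proof.
have [B B0 le_B] := raw_reward_norm_sum; exists B => // pi s.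
rewrite -lim_norm; last exact: raw_reward_cvg.
apply: limr_le; first by apply: is_cvg_norm; apply: raw_reward_cvg.
near=> n; apply: le_trans (le_B pi s n); exact: ler_norm_sum.
Unshelve. all: by end_near. Qed.

Lemma backup_cvg s u (phi : nat -> state -> R) (psi : state -> R) :
  (forall t, (phi n t @[n --> \oo] --> psi t)%classic) ->
  (backup P s u (phi n) @[n --> \oo] --> backup P s u psi)%classic.
Proof.
move=> cvg_phi; apply: cvgD.
  by apply: (cvg_big (@add_continuous R)) => b _; apply: cvgMl_tmp.
by case: u => [a|]; [case: ifP => _ //|]; apply: cvg_cst.
Qed.

Lemma raw_valueE pi s :
  raw_value pi s = gain s (pi s) + backup P s (pi s) (raw_value pi).
Proof.
apply/cvg_lim => //; rewrite -cvg_shiftS.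
rewrite [X in (X @ _ --> _)%classic](_ : _ =
    fun n => gain s (pi s) +
      backup P s (pi s) (fun t => series (raw_reward pi t) n)).
  apply: cvgD; first exact: cvg_cst.
  by apply: backup_cvg => t; apply: raw_reward_cvg.
apply/funext => n; rewrite /series /= big_nat_recl // raw_reward0 backup_sum.
by congr (_ + _); apply: eq_bigr => k _; rewrite raw_rewardS.
Qed.

End PolicyEvaluation.

(** * Bellman inequality, value of information, and comparison of sensor sets *)

Section Optimality.
Context {R : realType} {N Tmax : nat}.
Variable P : pos N -> pos N -> R.
Variables (r c D : R) (pi : policy N Tmax).
Hypotheses (r_gt0 : 0 < r) (c_gt0 : 0 < c) (D_gt0 : 0 < D).
Hypotheses (P_tm : transition_matrix P) (P_abs : absorbing_chain P).
Hypothesis pi_opt : optimal P r c D pi.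

Let P_ge0 x y : 0 <= P x y. Proof. by case: P_tm. Qed.
Local Notation state := (live N Tmax).
Local Notation W := (raw_value P r c D pi).

Lemma raw_value0 pi' (s : state) :
  mass P s (alive P 0) = 0 -> raw_value P r c D pi' s = 0.
Proof.
move=> s0; have [B _ /(_ pi' s)] :=
  raw_value_bound (Tmax := Tmax) r_gt0 c_gt0 D_gt0 P_tm P_abs.
by rewrite s0 mulr0 normr_le0 => /eqP.
Qed.

(** Optimality speaks only of possible states. On the others the belief is null and both raw values
    vanish, so the comparison holds everywhere. *)
Lemma raw_value_le pi' (s : state) :
  admissible pi' -> raw_value P r c D pi' s <= W s.
Proof.
move=> adm'.
have massE : \sum_(b : pos N) joint P s [:: b] = mass P s (fun=> 1).
  transitivity (mass P s (fun z => \sum_y P z y * 1)).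
    by rewrite mass_step; apply: eq_bigr => b _; rewrite joint1_mass mulr1.
  rewrite /mass; congr escape; apply/funext => z.
  by under eq_bigr do rewrite mulr1; case: P_tm.
have [s0|s_pos] := eqVneq (mass P s (fun=> 1)) 0.
  have alive0 : mass P s (alive P 0) = 0.
    apply/eqP; rewrite eq_le -[X in _ <= X]s0 mass_le //=; last first.
      by move=> x; rewrite alive_le1.
    by rewrite mass_ge0 // => x; rewrite alive_ge0.
  by rewrite !raw_value0.
have poss : possible P s.
  by rewrite /possible massE lt_neqAle eq_sym s_pos mass_ge0.
have := pi_opt.2 pi' adm' s poss.
by rewrite !valueE // ler_pM2r // invr_gt0.
Qed.

(** Otherwise, switching to [u] at [s] alone yields an admissible policy whose value is nowhere
    smaller and strictly larger at [s], against optimality. *)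
Lemma bellman (s : state) u : (u = Safe <-> age s = Tmax.+1) ->
  gain P r c D s u + backup P s u W <= W s.
Proof.
move=> adm_u; rewrite leNgt; apply/negP => lt_s.
pose pi' t := if pselect (t = s) then u else pi t.
have adm' : admissible pi'.
  move=> t; rewrite /pi'; case: pselect => [ts|_] /=; first by rewrite ts.
  exact: pi_opt.1.
have improves t : W t <= gain P r c D t (pi' t) + backup P t (pi' t) W.
  rewrite /pi'; case: pselect => [ts|_] /=; first by rewrite ts ltW.
  by rewrite -raw_valueE.
pose W' := raw_value P r c D pi'.
have W'E t : W' t = gain P r c D t (pi' t) + backup P t (pi' t) W'.
  exact: raw_valueE.
have step t : W t - W' t <= backup P t (pi' t) (fun t => W t - W' t).
  by rewrite backupB W'E; have := improves t; lra.
have [B B0 le_B] :=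
  raw_value_bound (Tmax := Tmax) r_gt0 c_gt0 D_gt0 P_tm P_abs.
(* The immediate gains cancel in [W - W'], so [step] can be iterated; each iteration lengthens the
   required survival by one step. The start bounds both values by [B], hence [B + B]. *)
have decay n t : W t - W' t <= (B + B) * mass P t (alive P n).
  elim: n t => [|n IH] t.
    have := (le_B pi t, le_B pi' t); rewrite !ler_norml mulrDl -/(W' t).
    by move=> [/andP[_ W_le] /andP[W'_ge _]]; lra.
  apply: (le_trans (step t)).
  by rewrite -(backup_alive P_tm t (pi' t)) -backupZ; apply: backup_le.
have W_le t : W t <= W' t.
  have lim0 : ((B + B) * mass P t (alive P n) @[n --> \oo] --> 0)%classic.
    rewrite -[X in (_ --> X)%classic](mulr0 (B + B)).
    by apply: cvgMl_tmp; apply: mass_alive_cvg0.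
  rewrite -subr_le0 -(cvg_lim (@Rhausdorff R) lim0).
  apply: limr_ge; first by apply/cvg_ex; exists 0.
  by apply: nearW => n; apply: decay.
have pi'_s : pi' s = u by rewrite /pi'; case: pselect.
have := backup_le P_ge0 s u W_le; have := raw_value_le s adm'.
rewrite -/(W' s) W'E pi'_s.
by move: lt_s; lra.
Qed.

Lemma backup_senseE (s : state) (a : {set cell N}) : (age s <= Tmax)%N ->
  gain P r c D s (Sense a) + backup P s (Sense a) W =
  \sum_(b : cell N) mass P s (P^~ (Some b)) *
     ((b \in a)%:R * (r + W (located b)) - c * #|a|%:R) + W (miss s a).
Proof.
move=> s_le; have s_max : (age s == Tmax.+1) = false by rewrite ltn_eqF.
rewrite gainE /backup s_max addrA (big_mkcond (resets _ _)) -big_split /=.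
congr (_ + _).
apply: eq_bigr => b _; rewrite s_max orbF.
by case: (b \in a) => /=; ring.
Qed.

Lemma backup_safeE (s : state) :
  gain P r c D s Safe + backup P s Safe W =
  \sum_(b : cell N) mass P s (P^~ (Some b)) * (r - D + W (located b)).
Proof.
by rewrite gainE /backup addr0 -big_split; apply: eq_bigr => b _ /=; ring.
Qed.

Lemma bellman_sense (s : state) (a : {set cell N}) : (age s <= Tmax)%N ->
  \sum_(b : cell N) mass P s (P^~ (Some b)) *
     ((b \in a)%:R * (r + W (located b)) - c * #|a|%:R) + W (miss s a) <= W s.
Proof.
move=> s_le; rewrite -backup_senseE //; apply: bellman; split=> // s_max.
by rewrite s_max ltnn in s_le.
Qed.

(* Below the maximal age the safe action is not admissible; sensing the whole
   grid replaces it, at no higher cost. *)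
Lemma bellman_safe (s : state) : c * (N ^ 2)%:R <= D ->
  \sum_(b : cell N) mass P s (P^~ (Some b)) * (r - D + W (located b)) <= W s.
Proof.
move=> le_D; have [s_max|s_max] := eqVneq (age s) Tmax.+1.
  by rewrite -backup_safeE; apply: bellman.
have s_le : (age s <= Tmax)%N by rewrite -ltnS ltn_neqAle s_max age_le.
apply: le_trans (bellman_sense [set: cell N] s_le).
rewrite raw_value0 ?addr0; last first.
  by rewrite mass_miss // big_pred0 // => -[b|] //=; rewrite inE.
apply: ler_sum => b _; rewrite ler_wpM2l ?mass_ge0 //.
rewrite inE mul1r cardsT card_prod card_ord mulnn.
by move: le_D; lra.
Qed.

(* The information obtained by splitting the possible paths into two classes
   cannot decrease the optimal value: both parts can imitate the policy of t. *)
Lemma raw_value_subadditive (t t1 t2 : state) w : c * (N ^ 2)%:R <= D ->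
  0 <= w -> (age t1 <= age t)%N -> (age t2 <= age t)%N ->
  (forall phi, mass P t phi = mass P t1 phi + w * mass P t2 phi) ->
  W t <= W t1 + w * W t2.
Proof.
move=> le_D w0; move En : (Tmax.+1 - age t)%N => n.
elim: n t t1 t2 En => [|n IH] t t1 t2 eq_n le1 le2 split_t.
  (* At maximal age [t] must use [Safe], but [t1] and [t2] may be younger; [bellman_safe] covers
     them at every age. *)
  have t_safe : pi t = Safe.
    by apply/(pi_opt.1 t)/eqP; rewrite eqn_leq age_le -subn_eq0 eq_n.
  rewrite raw_valueE // t_safe backup_safeE.
  apply: (@le_trans _ _ (
      \sum_(b : cell N) mass P t1 (P^~ (Some b)) * (r - D + W (located b)) +
      w * \sum_(b : cell N)
             mass P t2 (P^~ (Some b)) * (r - D + W (located b)))).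
    rewrite mulr_sumr -big_split le_eqVlt; apply/orP; left; apply/eqP.
    by apply: eq_bigr => b _; rewrite split_t /=; ring.
  by rewrite lerD ?ler_wpM2l ?bellman_safe.
have t_le : (age t <= Tmax)%N by rewrite -ltnS -subn_gt0 eq_n.
have [le1' le2'] := (leq_trans le1 t_le, leq_trans le2 t_le).
case pi_t : (pi t) => [a|]; last first.
  by have /pi_opt.1 t_max := pi_t; rewrite t_max ltnn in t_le.
rewrite raw_valueE // pi_t backup_senseE //.
(* If [t1] and [t2] play the action of [t], their beliefs after a miss again split that of [t], at
   the next age. *)
have le_miss : W (miss t a) <= W (miss t1 a) + w * W (miss t2 a).
  apply: IH => [|||phi]; rewrite ?age_miss //; first by rewrite subnS eq_n.
  rewrite !mass_miss // mulr_sumr -big_split.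
  by apply: eq_bigr => y _; rewrite split_t /=; ring.
apply: le_trans (lerD (bellman_sense a le1')
  (ler_wpM2l w0 (bellman_sense a le2'))).
rewrite mulrDr addrACA lerD // le_eqVlt; apply/orP; left; apply/eqP.
rewrite mulr_sumr -big_split.
by apply: eq_bigr => b _; rewrite split_t /=; ring.
Qed.

(** Adding [b] to [a] earns [r] whenever the target moves to [b] and costs [c] whenever it stays on
    the grid; optimality of [a] forbids a net profit. *)
Lemma unsensed_mass_le (s : state) (a : {set cell N}) b : c * (N ^ 2)%:R <= D ->
  (age s <= Tmax)%N -> pi s = Sense a -> b \notin a ->
  r * mass P s (P^~ (Some b)) <= c * \sum_(z : cell N) mass P s (P^~ (Some z)).
Proof.
move=> le_D s_le pi_s b_a.
have mass_b0 : 0 <= mass P s (P^~ (Some b)) by apply: mass_ge0.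
(* A miss under [a] is either a miss under [b |: a] or the target at [b], the latter with weight
   [mass P s (P^~ (Some b))]. *)
have le_miss : W (miss s a) <=
    W (miss s (b |: a)) + mass P s (P^~ (Some b)) * W (located b).
  apply: raw_value_subadditive => // [|phi]; first by rewrite !age_miss.
  rewrite !mass_miss // (bigD1 (Some b)) //= addrC; congr (_ + _).
  apply: eq_bigl => -[z|] //=; rewrite in_setU1 negb_or andbC.
  by congr (~~ _ && _); apply/eqP/eqP => [[]|->].
(* The Bellman inequality for [b |: a] is set against the equality for [a]. The terms at [b] are
   isolated, and elsewhere the two differ only by the cost of one sensor. *)
have := bellman_sense (b |: a) s_le.
rewrite [leRHS]raw_valueE // pi_s backup_senseE // cardsU1 b_a /=.
rewrite (bigD1 b) // [X in _ <= X + _](bigD1 b) //= setU11 (negbTE b_a).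
rewrite mulr_sumr [X in _ -> _ <= X](bigD1 b) //=.
have -> : \sum_(z | z != b) mass P s (P^~ (Some z)) *
     ((z \in b |: a)%:R * (r + W (located z)) - c * (1 + #|a|)%:R) =
   \sum_(z | z != b) mass P s (P^~ (Some z)) *
     ((z \in a)%:R * (r + W (located z)) - c * #|a|%:R) -
   \sum_(z | z != b) c * mass P s (P^~ (Some z)).
  rewrite -sumrB; apply: eq_bigr => z zb.
  by rewrite in_setU1 (negbTE zb) natrD; ring.
by rewrite natrD; move: le_miss; lra.
Qed.

End Optimality.

(** * Return to conditional probabilities *)

Unset Implicit Arguments.

Theorem theorem2 (R : realType) (N Tmax : nat) (P : pos N -> pos N -> R)
    (r c D : R) (pi : policy N Tmax) :
  (0 < Tmax)%N -> 0 < r -> 0 < c -> 0 < D ->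
  c * (N ^ 2)%:R <= D ->
  transition_matrix P -> absorbing_chain P ->
  optimal P r c D pi ->
  forall s : live N Tmax, (age s <= Tmax)%N ->
  forall b : cell N, c / r < cond_prob P s [:: Some b] ->
  exists2 a : {set cell N}, pi s = Sense a & b \in a.
Proof.
move=> _ r0 c0 D0 le_D P_tm P_abs pi_opt s s_le b lt_b.
have P_ge0 x y : 0 <= P x y by case: P_tm.
case pi_s : (pi s) => [a|]; last first.
  by have /pi_opt.1 s_max := pi_s; rewrite s_max ltnn in s_le.
exists a => //; apply/negPn/negP => b_a.
have := unsensed_mass_le r0 c0 D0 P_tm P_abs pi_opt le_D s_le pi_s b_a.
have total_ge0 : 0 <= \sum_y joint P s [:: y].
  by apply: sumr_ge0 => y _; rewrite joint1_mass mass_ge0.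
(* With a null denominator the quotient is 0 by convention, which cannot exceed [c / r]. *)
have total_gt0 : 0 < \sum_y joint P s [:: y].
  rewrite lt_neqAle total_ge0 andbT; apply/eqP => total0.
  move: lt_b; rewrite /cond_prob -total0 invr0 mulr0 ltNge.
  by rewrite divr_ge0 // ltW.
apply/negP; rewrite -ltNge.
move: lt_b; rewrite /cond_prob joint1_mass ltr_pdivlMr // mulrAC ltr_pdivrMr //.
rewrite [ltRHS]mulrC; apply: le_lt_trans; rewrite ler_pM2l //.
(* The normalising total also counts exit from the grid, so it is at least the on-grid mass to which
   the cost applies. *)
rewrite [leRHS](bigD1 None) //= big_pos //=.
under [in leRHS]eq_bigr do rewrite joint1_mass.
by rewrite lerDr joint1_mass mass_ge0.
Qed.
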